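(* Let $\Lambda$ be a row-finite $k$-graph without sources. Then the following statements are equivalent. (i) $\operatorname{Spec}_{\mathbb Z^k}(T_\Lambda)$ is connected as a topological space. (ii) $T_\Lambda$ is indecomposable as a $\mathbb Z^k$-monoid. (iii) There is no pair $(H_1,H_2)\in\mathcal H_\Lambda\times\mathcal H_\Lambda$ such that $H_1,H_2\ne\emptyset$, $H_1\cap H_2=\emptyset$, and $\overline{H_1\cup H_2}=\Lambda^0$. Moreover, if any one of the conditions (i), (ii), (iii) holds, then $\Lambda$ is connected as a $k$-graph.
   Context: $k\ge1$ is an integer, $\mathbb N\ni0$. A $k$-graph is a countable small category $\Lambda$ with a functor $d:\Lambda\to\mathbb N^k$ such that whenever $d(\lambda)=\mathbf m+\mathbf n$ there are unique $\alpha,\beta$ with $d(\alpha)=\mathbf m$, $d(\beta)=\mathbf n$, $\lambda=\alpha\beta$. Objects are identified with $\Lambda^0=d^{-1}(0)$; $r,s$ denote codomain and domain; $v\Lambda^{\mathbf n}=\{\lambda: d(\lambda)=\mathbf n,\ r(\lambda)=v\}$; $u\Lambda v=\{\lambda: r(\lambda)=u,\ s(\lambda)=v\}$. $\Lambda$ is row-finite if every $v\Lambda^{\mathbf n}$ is finite, and without sources if every $v\Lambda^{\mathbf n}$ is nonempty. $\Lambda$ is connected if the equivalence relation on $\Lambda^0$ generated by $\{(u,v):u\Lambda v\ne\emptyset\}$ is all of $\Lambda^0\times\Lambda^0$. $H\subseteq\Lambda^0$ is hereditary if $v\in H$ implies $s(v\Lambda^{\mathbf n})\subseteq H$ for all $\mathbf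 n\in\mathbb N^k$; saturated if $s(v\Lambda^{\mathbf n})\subseteq H$ for some $\mathbf n\in\mathbb N^k$ implies $v\in H$. $\mathcal H_\Lambda$ is the set of hereditary saturated subsets of $\Lambda^0$, and $\overline X$ is the smallest hereditary saturated subset containing $X\subseteq\Lambda^0$. The talented monoid $T_\Lambda$ is the commutative monoid generated by $v(\mathbf n)$ ($v\in\Lambda^0$, $\mathbf n\in\mathbb Z^k$) subject to $v(\mathbf n)=\sum_{\alpha\in v\Lambda^{\mathbf m}}s(\alpha)(\mathbf n+\mathbf m)$ for $v\in\Lambda^0,\mathbf n\in\mathbb Z^k,\mathbf m\in\mathbb N^k$, with $\mathbb Z^k$ acting by ${}^{\mathbf q}v(\mathbf n)=v(\mathbf n+\mathbf q)$. $x\le y$ iff $y=x+z$ for some $z$. A $\mathbb Z^k$-order ideal is a submonoid that is a down-set for $\le$ and closed under $\mathbb Z^k$. A proper $\mathbb Z^k$-order ideal $P$ is prime if for $\mathbb Z^k$-order ideals $J_1,J_2$, $J_1\cap J_2\subseteq P$ implies $J_1\subseteq P$ or $J_2\subseteq P$. $\operatorname{Spec}_{\mathbb Z^k}(T_\Lambda)$ is the set of these, with closed sets $\{P:J\subseteq P\}$, $J$ a $\mathbb Z^k$-order ideal. $T_\Lambda$ is decomposable if there are proper $\mathbb Z^k$-order ideals $J_1,J_2$ with $J_1\cap J_2=\{0\}$ such that the $\mathbb Z^k$-order ideal generated by $J_1\cup J_2$ is $T_\Lambda$; otherwise it is indecomposable. *)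

(* Defs.v *)
From HB Require Import structures.
From Stdlib Require Import Relation_Operators.
From mathcomp Require Import all_boot all_order all_algebra.
From mathcomp Require Import generic_quotient finmap multiset.
From mathcomp Require Import boolp classical_sets functions cardinality fsbigop.
From mathcomp Require Import topology.

Set Implicit Arguments.
Unset Strict Implicit.
Unset Printing Implicit Defensive.

Import GRing.Theory.

Local Open Scope classical_set_scope.
Local Open Scope ring_scope.

(* N^k is 'rV[nat]_k and Z^k is 'rV[int]_k. *)
Definition natz_row (k : nat) (m : 'rV[nat]_k) : 'rV[int]_k :=
  map_mx Posz m.

(* A countable small category with a degree functor to N^k satisfying unique
   factorization. Composition is a total function on morphisms, but it is only
   constrained (and only ever used) on composable pairs, i.e. those with
   src a = rng b; its other values carry no meaning. *)
Record kgraph (k : nat) := KGraph {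
  obj : countType;
  mor : countType;
  rng : mor -> obj;
  src : mor -> obj;
  idm : obj -> mor;
  mcomp : mor -> mor -> mor;
  deg : mor -> 'rV[nat]_k;
  rng_idm : forall v, rng (idm v) = v;
  src_idm : forall v, src (idm v) = v;
  rng_comp : forall a b, src a = rng b -> rng (mcomp a b) = rng a;
  src_comp : forall a b, src a = rng b -> src (mcomp a b) = src b;
  mcomp1m : forall a, mcomp (idm (rng a)) a = a;
  mcompm1 : forall a, mcomp a (idm (src a)) = a;
  mcompA : forall a b c, src a = rng b -> src b = rng c ->
    mcomp a (mcomp b c) = mcomp (mcomp a b) c;
  deg_idm : forall v, deg (idm v) = 0;
  deg_comp : forall a b, src a = rng b -> deg (mcomp a b) = deg a + deg b;
  factorization : forall l m n, deg l = m + n ->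
    exists! ab : mor * mor, [/\ deg ab.1 = m, deg ab.2 = n,
      src ab.1 = rng ab.2 & mcomp ab.1 ab.2 = l]
}.

Section KGraph.
Variables (k : nat) (L : kgraph k).
Implicit Types (u v : obj L) (m n : 'rV[nat]_k) (p q : 'rV[int]_k) (H X : set (obj L)).

Definition paths v n : set (mor L) := [set a | deg a = n /\ rng a = v].

Definition row_finite := forall v n, finite_set (paths v n).

Definition without_sources := forall v n, paths v n !=set0.

Definition kgraph_connected := forall u v,
  clos_refl_sym_trans (obj L)
    (fun x y => exists a : mor L, rng a = x /\ src a = y) u v.

Definition hereditary H := forall v, H v -> forall n, @src k L @` paths v n `<=` H.

Definition saturated H := forall v,
  (exists n, @src k L @` paths v n `<=` H) -> H v.

Definition hereditary_saturated H := hereditary H /\ saturated H.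

Definition hs_closure X : set (obj L) := smallest hereditary_saturated X.

(* The free commutative monoid on the symbols v(p), written additively. *)
Definition free_mon := {mset obj L * 'rV[int]_k}%mset.

HB.instance Definition _ := Choice.on free_mon.
HB.instance Definition _ := GRing.isNmodule.Build free_mon
  (@msetDA _) (@msetDC _) (@mset0D _).

Definition fgen v p : free_mon := msetn 1 (v, p).

(* The least congruence containing the defining relations of the talented
   monoid. The sum over a set is meaningful when the set is finite, that is,
   for row-finite k-graphs. *)
Inductive tcong : free_mon -> free_mon -> Prop :=
| tcong_rel v p m :
    tcong (fgen v p) (\sum_(a \in paths v m) fgen (src a) (p + natz_row m))
| tcong_refl x : tcong x x
| tcong_sym x y : tcong x y -> tcong y x
| tcong_trans y x z : tcong x y -> tcong y z -> tcong x z
| tcong_add x y x' y' : tcong x y -> tcong x' y' -> tcong (x + x') (y + y').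

Definition tcongb : rel free_mon := fun x y => `[< tcong x y >].

Lemma tcongb_refl : reflexive tcongb.
Proof. by move=> x; apply/asboolP; exact: tcong_refl. Qed.

Lemma tcongb_sym : symmetric tcongb.
Proof. by move=> x y; apply/asboolP/asboolP; exact: tcong_sym. Qed.

Lemma tcongb_trans : transitive tcongb.
Proof.
by move=> y x z /asboolP xy /asboolP yz; apply/asboolP; exact: tcong_trans yz.
Qed.

Canonical tcong_equiv := EquivRel tcongb tcongb_refl tcongb_sym tcongb_trans.

Definition talented := {eq_quot tcong_equiv}%qT.

HB.instance Definition _ := Choice.on talented.
HB.instance Definition _ := EqQuotient.on talented.

Definition tproj (x : free_mon) : talented := (\pi_talented x)%qT.

Lemma tprojP x y : tproj x = tproj y <-> tcong x y.
Proof. by split=> [/eqmodP/asboolP|xy]; last exact/eqmodP/asboolP. Qed.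

Lemma tprojK (t : talented) : tproj (repr t) = t.
Proof. exact: reprK. Qed.

Lemma tcong_repr x : tcong (repr (tproj x)) x.
Proof. by apply/tprojP; rewrite tprojK. Qed.

Definition tzero : talented := tproj 0.
Definition tadd (s t : talented) : talented := tproj (repr s + repr t).

Lemma tadd_proj x y : tadd (tproj x) (tproj y) = tproj (x + y).
Proof. by apply/tprojP/tcong_add; exact: tcong_repr. Qed.

Fact taddA : associative tadd.
Proof.
move=> a b c; rewrite -(tprojK a) -(tprojK b) -(tprojK c).
by rewrite !tadd_proj addrA.
Qed.

Fact taddC : commutative tadd.
Proof. by move=> a b; rewrite -(tprojK a) -(tprojK b) !tadd_proj addrC. Qed.

Fact tadd0 : left_id tzero tadd.
Proof. by move=> a; rewrite -(tprojK a) tadd_proj add0r. Qed.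

HB.instance Definition _ := GRing.isNmodule.Build talented taddA taddC tadd0.

Definition tgen v p : talented := tproj (fgen v p).

(* The action of q on the free monoid, extending v(p) |-> v(p + q), and the
   action it induces on the quotient, see tshift_proj and tshift_tgen. *)
Definition fshift q (x : free_mon) : free_mon :=
  \sum_(g <- enum_mset x) fgen g.1 (g.2 + q).

Definition tshift q (t : talented) : talented :=
  tproj (fshift q (repr t)).

Lemma fshift_fgen q v p : fshift q (fgen v p) = fgen v (p + q).
Proof. by rewrite /fshift /fgen enum_msetn big_seq1. Qed.

Lemma fshift0 q : fshift q 0 = 0.
Proof. by rewrite /fshift enum_mset0 big_nil. Qed.

Lemma fshiftD q x y : fshift q (x + y) = fshift q x + fshift q y.
Proof.
rewrite /fshift -big_cat; apply: perm_big; apply/allP => g _ /=.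
by rewrite count_cat !count_mem_mset msetE2.
Qed.

Lemma fgen_neq0 v p : fgen v p <> 0.
Proof.
move/(congr1 (fun x : free_mon => x (v, p))).
by rewrite msetnxx mset0E.
Qed.

Lemma fgen_support (A : set (mor L)) (f : mor L -> obj L) (g : mor L -> 'rV_k) :
  finite_support 0 A (fun a => fgen (f a) (g a)) = fset_set A.
Proof.
rewrite /finite_support unlock; congr (enum_fset (fset_set _)).
by apply/seteqP; split=> [a []|a Aa] //; split=> //; exact: fgen_neq0.
Qed.

Lemma fshift_tcong q x y : tcong x y -> tcong (fshift q x) (fshift q y).
Proof.
elim=> {x y} [v p m|x|x y _|y x z _ xy _|x y x' y' _ xy _ xy'].
- rewrite fshift_fgen (big_morph _ (fshiftD q) (fshift0 q)).
  have := tcong_rel v (p + q) m.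
  rewrite !fgen_support.
  by under [in X in _ -> X]eq_bigr do rewrite fshift_fgen addrAC.
- exact: tcong_refl.
- exact: tcong_sym.
- exact: tcong_trans.
- by rewrite !fshiftD; exact: tcong_add.
Qed.

Lemma tshift_proj q x : tshift q (tproj x) = tproj (fshift q x).
Proof. exact/tprojP/fshift_tcong/tcong_repr. Qed.

Lemma tshift_tgen q v p : tshift q (tgen v p) = tgen v (p + q).
Proof. by rewrite tshift_proj fshift_fgen. Qed.

Lemma tshiftD q s t : tshift q (s + t) = tshift q s + tshift q t.
Proof.
rewrite -(tprojK s) -(tprojK t) [tproj _ + tproj _]tadd_proj !tshift_proj.
by rewrite fshiftD -tadd_proj.
Qed.

End KGraph.

(* act is meant to be an action of G on T by monoid automorphisms; the axioms of
   an action play no role in the definitions. *)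
Section OrderIdeals.
Variables (G : Type) (T : nmodType) (act : G -> T -> T).
Implicit Types (I J P : set T) (x y : T).

Definition alg_le x y := exists z, y = x + z.

Definition order_ideal J :=
  [/\ J 0, forall x y, J x -> J y -> J (x + y),
      forall x y, alg_le x y -> J y -> J x
    & forall g x, J x -> J (act g x)].

Definition proper_ideal J := order_ideal J /\ J <> setT.

Definition prime_ideal P := proper_ideal P /\
  forall J1 J2, order_ideal J1 -> order_ideal J2 ->
    J1 `&` J2 `<=` P -> J1 `<=` P \/ J2 `<=` P.

Definition ideal_closure (X : set T) : set T := smallest order_ideal X.

Definition decomposable := exists J1 J2,
  [/\ proper_ideal J1, proper_ideal J2, J1 `&` J2 = [set 0]
    & ideal_closure (J1 `|` J2) = setT].

Definition indecomposable := ~ decomposable.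

Record Spec := MkSpec {
  spec_ideal :> set T;
  spec_prime : prime_ideal spec_ideal
}.

HB.instance Definition _ := gen_eqMixin Spec.
HB.instance Definition _ := gen_choiceMixin Spec.

Definition vanishing J : set Spec := [set P : Spec | J `<=` P].

(* A set is open when its complement is vanishing J for an order ideal J. *)
Definition spec_open (U : set Spec) :=
  exists2 J, order_ideal J & ~` U = vanishing J.

Lemma order_idealT : order_ideal setT.
Proof. by split. Qed.

Lemma order_idealI J1 J2 :
  order_ideal J1 -> order_ideal J2 -> order_ideal (J1 `&` J2).
Proof.
move=> [z1 a1 d1 g1] [z2 a2 d2 g2]; split=> //.
- by move=> x y [? ?] [? ?]; split; [exact: a1|exact: a2].
- by move=> x y xy [? ?]; split; [exact: d1 xy _|exact: d2 xy _].
- by move=> g x [? ?]; split; [exact: g1|exact: g2].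
Qed.

Lemma order_ideal_closure (X : set T) : order_ideal (ideal_closure X).
Proof.
split=> [J [[]]//|x y Jx Jy J HJ|x y xy Jy J HJ|g x Jx J HJ].
- by have [[_ + _ _] _] := HJ; apply; [exact: Jx|exact: Jy].
- by have [[_ _ + _] _] := HJ; apply; [exact: xy|exact: Jy].
- by have [[_ _ _ +] _] := HJ; apply; exact: Jx.
Qed.

Fact spec_openT : spec_open setT.
Proof.
exists setT; first exact: order_idealT.
rewrite setCT; apply/seteqP; split=> // P TP.
by have [[_ PT] _] := spec_prime P; apply: PT; apply/seteqP; split.
Qed.

Fact spec_openI : setI_closed spec_open.
Proof.
move=> U1 U2 [J1 i1 e1] [J2 i2 e2].
exists (J1 `&` J2); first exact: order_idealI.
rewrite setCI e1 e2; apply/seteqP; split=> P.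
  by case=> JP x [? ?]; exact: JP.
by have [_ + JP] := spec_prime P; exact.
Qed.

Fact spec_open_bigU (I : Type) (f : I -> set Spec) :
  (forall i, spec_open (f i)) -> spec_open (\bigcup_i f i).
Proof.
move=> fo.
exists (ideal_closure [set x | exists i J,
  [/\ order_ideal J, ~` f i = vanishing J & J x]]).
  exact: order_ideal_closure.
apply/seteqP; split=> P.
  rewrite setC_bigcup => fP; apply: smallest_sub; first by have [[]] := spec_prime P.
  move=> x [i [J [_ e Jx]]]; have := fP i Logic.I; rewrite e; exact.
move=> JP [i _ fiP]; have [J iJ e] := fo i.
have : (~` f i) P.
  by rewrite e => x Jx; apply: JP => M [_]; apply; exists i, J.
exact.
Qed.

HB.instance Definition _ :=
  isOpenTopological.Build Spec spec_openT spec_openI spec_open_bigU.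

Lemma spec_closedE (C : set Spec) :
  closed C <-> exists2 J, order_ideal J & C = vanishing J.
Proof.
rewrite -openC (_ : open (~` C) = spec_open (~` C)) // /spec_open setCK.
by split=> -[J]; exists J.
Qed.

End OrderIdeals.

(* Main.v *)
(* Order ideals of the talented monoid correspond to hereditary saturated sets
   of vertices, through the representatives supported in such a set; this gives
   (ii) <-> (iii). The equivalence (i) <-> (ii) holds for every conical monoid
   in which each order ideal is an intersection of prime ones. Here a vertex
   outside a hereditary saturated set [H] starts an infinite path avoiding [H],
   and the vertices that do not reach this path form a hereditary saturated set
   containing [H]. Its ideal is prime, because the vertices that reach the path
   are downward directed. Finally, a connected component and its complement are
   both hereditary and saturated, so a disconnected k-graph splits. *)

Require Import Defs.
From Stdlib Require Import Relation_Operators.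
From mathcomp Require Import all_boot all_order all_algebra.
From mathcomp Require Import finmap multiset.
From mathcomp Require Import boolp classical_sets cardinality fsbigop topology.

Set Implicit Arguments.
Unset Strict Implicit.
Unset Printing Implicit Defensive.

Import GRing.Theory.

Local Open Scope classical_set_scope.
Local Open Scope ring_scope.

(** * Generating the whole type, and predicates compatible with sums *)

Lemma smallest_eqT (T : Type) (C : set T -> Prop) (X : set T) :
  smallest C X = setT <-> (forall M, C M -> X `<=` M -> M = setT).
Proof.
split=> [XT M CM XM|CT].
  by apply/seteqP; split=> // x _; have : smallest C X x by [rewrite XT]; exact.
by apply/seteqP; split=> // x _ M [CM XM]; rewrite (CT M).
Qed.

(** Used both for membership in an order ideal and for [supported H]. *)
Lemma big_additive (T : nmodType) (Q : T -> Prop) (I : eqType) (s : seq I)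
    (F : I -> T) :
  Q 0 -> (forall x y, Q (x + y) <-> Q x /\ Q y) ->
  Q (\sum_(i <- s) F i) <-> (forall i, i \in s -> Q (F i)).
Proof.
move=> Q0 QD; elim: s => [|i s IH]; first by rewrite big_nil; split.
rewrite big_cons; split.
  case/QD=> Qi /IH Qs j; rewrite inE => /orP[/eqP->//|]; exact: Qs.
move=> Qs; apply/QD; split; first by apply: Qs; rewrite mem_head.
by apply/IH => j js; apply: Qs; rewrite inE js orbT.
Qed.

(** * Order ideals and connectedness of the prime spectrum *)

Section OrderIdeals.
Variables (G : Type) (T : nmodType) (act : G -> T -> T).

Lemma order_idealD (J : set T) x y :
  order_ideal act J -> J (x + y) <-> J x /\ J y.
Proof.
move=> [_ JD Jle _]; split=> [Jxy|[]]; last exact: JD.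
by split; apply: Jle Jxy; [exists y|exists x; rewrite addrC].
Qed.

(** Separation puts every proper order ideal inside a prime, so the ideal generated by a set lying
    in no prime cannot be proper. *)
Lemma vanishing_eq0P (X : set T) :
  (forall J x, order_ideal act J -> ~ J x ->
    exists2 P : Spec act, J `<=` P & ~ spec_ideal P x) ->
  (forall P : Spec act, ~ X `<=` P) <-> ideal_closure act X = setT.
Proof.
move=> sep; split=> [XP|/smallest_eqT XT P XP]; last first.
  by have [[iP PT] _] := spec_prime P; apply: PT; exact: XT.
apply/smallest_eqT => J iJ XJ; apply/seteqP; split=> // x _.
apply: contrapT => /(sep _ _ iJ) [P JP _].
exact: XP P (subset_trans XJ JP).
Qed.

(** The assumption on [[set 0]] encodes conicality. Two vanishing sets are disjoint when their
    ideals jointly generate the monoid and cover the spectrum when the ideals meet in 0, so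
    decompositions match nontrivial clopen sets. *)
Lemma connected_spec_indecomposable :
  order_ideal act [set 0] ->
  (forall J x, order_ideal act J -> ~ J x ->
    exists2 P : Spec act, J `<=` P & ~ spec_ideal P x) ->
  connected [set: Spec act] <-> indecomposable act.
Proof.
move=> i0 sep; split.
- move=> conn [J1 [J2 [[i1 p1] [i2 p2] J120 /(vanishing_eq0P _ sep) J12T]]].
  have nonempty J : order_ideal act J -> J <> setT ->
      exists P : Spec act, J `<=` P.
    move=> iJ /eqP/setTPn [x /(sep _ _ iJ) [P JP _]].
    by exists P.
  have J12 (P : Spec act) : J1 `<=` P \/ J2 `<=` P.
    have [[[P0 _ _ _] _] +] := spec_prime P; apply=> // x.
    by rewrite J120 => ->.
  have J12N (P : Spec act) : J1 `<=` P -> ~ J2 `<=` P.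
    by move=> J1P J2P; apply: (J12T P) => x []; [exact: J1P|exact: J2P].
  have [P2 J2P2] := nonempty _ i2 p2.
  have closedV J : order_ideal act J -> closed (vanishing J : set (Spec act)).
    by move=> iJ; apply/spec_closedE; exists J.
  have V12 : ~` vanishing J2 = vanishing J1 :> set (Spec act).
    by apply/seteqP; split=> P; [case: (J12 P)|move=> /J12N].
  have V1T : vanishing J1 = setT :> set (Spec act).
    apply: conn; first exact: nonempty.
      by exists (vanishing J1); rewrite ?setTI // -V12 openC; exact: closedV.
    by exists (vanishing J1); rewrite ?setTI //; exact: closedV.
  by apply: (J12N P2) => //; have : vanishing J1 P2 by rewrite V1T.
(* A clopen [B] and its complement are both vanishing sets; if neither is empty, their ideals
   decompose the monoid. *)
- move=> indec B [P0 BP0] [U Uo BU] [V Vc BV].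
  rewrite !setTI in BU BV; subst V; subst U.
  apply: contrapT => BT; apply: indec.
  have [J1 i1 B1] : exists2 J, order_ideal act J & B = vanishing J
    by exact/spec_closedE.
  have [J2 i2 B2] : exists2 J, order_ideal act J & ~` B = vanishing J
    by apply/spec_closedE; exact: open_closedC.
  have prop (P : Spec act) J : J `<=` P -> J <> setT.
    move=> JP JT; have [[_ PT] _] := spec_prime P; apply: PT.
    by apply/seteqP; split=> // x _; apply: JP; rewrite JT.
  exists J1, J2; split.
  + by split=> //; apply: (prop P0); move: BP0; rewrite B1.
  + split=> //; have /eqP/setTPn [P BP] := BT.
    by apply: (prop P); have : (~` B) P by []; rewrite B2.
  (* A common element of the two ideals lies in every prime, while a nonzero one would be missed by
     some prime. *)
  + apply/seteqP; split=> [x [J1x J2x]|x ->]; last by case: i1 i2 => ? _ _ _ [].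
    apply: contrapT => x0.
    have [P _ Px] := sep _ _ i0 x0; apply: Px.
    have [|BP] := EM (B P); first by rewrite B1; exact.
    have : (~` B) P by []. by rewrite B2; exact.
  + apply/vanishing_eq0P => // P J12P.
    have : (~` B) P by rewrite B2 => x J2x; apply: J12P; right.
    by apply; rewrite B1 => x J1x; apply: J12P; left.
Qed.

End OrderIdeals.

(** * Order ideals of the talented monoid and hereditary saturated sets *)

Section TalentedIdeals.
Variables (k : nat) (L : kgraph k).
Hypotheses (hrf : row_finite L) (hns : without_sources L).
Implicit Types (u v : obj L) (H : set (obj L)) (x y : free_mon L)
  (t : talented L) (J : set (talented L)).

Local Notation hs := (@hereditary_saturated k L).
Local Notation ideal := (order_ideal (@tshift k L)).

Lemma hs_paths H v n : hs H ->
  H v <-> (forall a, paths v n a -> H (src a)).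
Proof.
move=> [Hh Hs]; split=> [Hv a va|Hn].
  by apply: (Hh v Hv n); exists a.
by apply: Hs; exists n => _ [a va <-]; exact: Hn.
Qed.

(** A vertex with no path of some degree [n] would lie in every saturated set; the absence of
    sources excludes this. *)
Lemma hs_set0 : hs set0.
Proof.
split=> [//|v [n vn]]; have [a va] := hns v n.
by apply: (vn (src a)); exists a.
Qed.

Lemma free_mon_sum x : x = \sum_(g <- enum_mset x) fgen g.1 g.2.
Proof.
apply/msetP => h; rewrite -count_mem_mset.
elim: (enum_mset x) => [|[v p] s IH]; first by rewrite big_nil mset0E.
by rewrite big_cons msetE2 -IH /= /fgen msetnE eq_sym; case: eqP.
Qed.

Lemma tproj_sum x : tproj x = \sum_(g <- enum_mset x) tgen g.1 g.2.
Proof.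
rewrite {1}(free_mon_sum x).
by apply: (big_morph (@tproj k L)) => // ? ?; rewrite -tadd_proj.
Qed.

Lemma tproj_fsbig v n (F : mor L -> 'rV[int]_k) :
  tproj (\sum_(a \in paths v n) fgen (src a) (F a)) =
  \sum_(a <- fset_set (paths v n)) tgen (src a) (F a).
Proof.
rewrite fgen_support.
by apply: (big_morph (@tproj k L)) => // ? ?; rewrite -tadd_proj.
Qed.

Lemma tgen_rel v p n :
  tgen v p = \sum_(a <- fset_set (paths v n)) tgen (src a) (p + natz_row n).
Proof. by rewrite -tproj_fsbig; apply/tprojP; exact: tcong_rel. Qed.

Lemma ideal_sum J (I : eqType) (s : seq I) (F : I -> talented L) : ideal J ->
  J (\sum_(i <- s) F i) <-> (forall i, i \in s -> J (F i)).
Proof.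
move=> iJ; apply: big_additive => [|x y]; last exact: order_idealD iJ.
by case: iJ.
Qed.

Definition vertices_of J : set (obj L) := [set v | J (tgen v 0)].

Lemma ideal_tgen J v p : ideal J -> J (tgen v p) <-> vertices_of J v.
Proof.
move=> [_ _ _ Jsh]; split=> [/(Jsh (- p))|/(Jsh p)]; rewrite tshift_tgen.
  by rewrite subrr.
by rewrite add0r.
Qed.

Definition supported H x := forall g, (0 < x g)%N -> H g.1.

Lemma supported0 H : supported H 0.
Proof. by move=> g; rewrite mset0E. Qed.

Lemma supportedD H x y : supported H (x + y) <-> supported H x /\ supported H y.
Proof.
have E g : (x + y) g = (x g + y g)%N by rewrite msetE2.
split=> [Hxy|[Hx Hy] g]; last by rewrite E addn_gt0 => /orP[]; auto.
by split=> g xg; apply: Hxy; rewrite E addn_gt0 xg ?orbT.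
Qed.

Lemma supported_fgen H v p : supported H (fgen v p) <-> H v.
Proof.
split=> [/(_ (v, p))|Hv g]; rewrite /fgen msetnE ?eqxx; first exact.
by case: eqP => // ->.
Qed.

(* The two closure properties of [H] say exactly that the defining relations
   preserve being supported in [H], in either direction. *)
Lemma supported_tcong H x y : hs H -> tcong x y -> supported H x <-> supported H y.
Proof.
move=> HH; elim=> {x y} [v p n|x|x y _|y x z _ xy _ yz|x y x' y' _ xy _ xy'] //.
- rewrite fgen_support supported_fgen.
  rewrite (big_additive _ _ (supported0 H) (supportedD H)) (hs_paths v n HH).
  split=> Hn a va.
    apply/supported_fgen/Hn.
    by move: va; rewrite in_fset_set; [rewrite inE|exact: hrf].
  apply/supported_fgen/Hn.
  by rewrite in_fset_set ?inE //; exact: hrf.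
- by case=> ? ?; split.
- by rewrite xy yz.
- by rewrite !supportedD xy xy'.
Qed.

(** The choice of representative is harmless for hereditary saturated [H], by [supported_tcong]. *)
Definition ideal_of H : set (talented L) := [set t | supported H (repr t)].

Lemma ideal_of_proj H x : hs H -> ideal_of H (tproj x) <-> supported H x.
Proof. by move=> HH; apply: supported_tcong => //; exact: tcong_repr. Qed.

Lemma ideal_of_tgen H v p : hs H -> ideal_of H (tgen v p) <-> H v.
Proof. by move=> HH; rewrite ideal_of_proj // supported_fgen. Qed.

Lemma ideal_ofD H s t : hs H ->
  ideal_of H (s + t) <-> ideal_of H s /\ ideal_of H t.
Proof.
move=> HH; rewrite -(tprojK s) -(tprojK t) [tproj _ + _]tadd_proj.
by rewrite !ideal_of_proj // supportedD.
Qed.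

Lemma order_ideal_of H : hs H -> ideal (ideal_of H).
Proof.
move=> HH; have H0 : ideal_of H 0 by apply/ideal_of_proj => //; exact: supported0.
split=> //.
- by move=> s t Hs Ht; apply/ideal_ofD.
- by move=> s _ [t ->] /(ideal_ofD _ _ HH) [].
- move=> q t; rewrite -(tprojK t) tshift_proj => /(ideal_of_proj _ HH) Ht.
  rewrite ideal_of_proj // /fshift.
  apply/(big_additive _ _ (supported0 H) (supportedD H)) => g gt.
  by apply/supported_fgen/Ht; rewrite -in_mset.
Qed.

(** An order ideal contains a sum exactly when it contains each term. Applied to [tgen_rel], one
    direction gives heredity and the other saturation. *)
Lemma hs_vertices_of J : ideal J -> hs (vertices_of J).
Proof.
move=> iJ.
have paths_in v n : vertices_of J v <-> @src k L @` paths v n `<=` vertices_of J.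
  rewrite -(ideal_tgen v 0 iJ) (tgen_rel v 0 n) ideal_sum //; split=> Jn.
    move=> _ [a va <-]; rewrite -(ideal_tgen _ (0 + natz_row n) iJ); apply: Jn.
    by rewrite in_fset_set ?inE //; exact: hrf.
  move=> a; rewrite in_fset_set ?inE; last exact: hrf.
  by move=> va; rewrite ideal_tgen //; apply: Jn; exists a.
split=> [v Jv n|v [n vn]]; first exact/paths_in.
exact/(paths_in v n).
Qed.

Lemma vertices_ofK J : ideal J -> ideal_of (vertices_of J) = J.
Proof.
move=> iJ; have HJ := hs_vertices_of iJ; apply/seteqP.
split=> t; rewrite -(tprojK t) (ideal_of_proj _ HJ) tproj_sum ideal_sum // => Jt.
  by move=> g gt; rewrite ideal_tgen //; apply: Jt; rewrite -in_mset.
by move=> g gt; rewrite -(ideal_tgen _ g.2 iJ); apply: Jt; rewrite in_mset.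
Qed.

Lemma ideal_ofK H : hs H -> vertices_of (ideal_of H) = H.
Proof. by move=> HH; apply/seteqP; split=> v; rewrite -{1}(ideal_of_tgen v 0 HH). Qed.

Lemma ideal_ofS H1 H2 : H1 `<=` H2 -> ideal_of H1 `<=` ideal_of H2.
Proof. by move=> H12 t Ht g /Ht/H12. Qed.

Lemma ideal_ofT : ideal_of setT = setT.
Proof. by apply/seteqP; split. Qed.

Lemma ideal_ofI H1 H2 : ideal_of (H1 `&` H2) = ideal_of H1 `&` ideal_of H2.
Proof.
apply/seteqP; split=> [t Ht|t [H1t H2t] g gt]; first by split=> g /Ht [].
by split; [exact: H1t|exact: H2t].
Qed.

Lemma ideal_of0 : ideal_of set0 = [set 0].
Proof.
have H0 := hs_set0; apply/seteqP; split=> [t t0|_ ->]; last first.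
  by apply/ideal_of_proj => //; exact: supported0.
rewrite /= -(tprojK t) tproj_sum big_seq big1 // => g.
by rewrite in_mset => /t0.
Qed.

Lemma decomposable_split :
  decomposable (@tshift k L) <-> exists H1 H2 : set (obj L),
    [/\ hs H1 /\ hs H2, H1 <> set0 /\ H2 <> set0, H1 `&` H2 = set0
      & hs_closure (H1 `|` H2) = setT].
Proof.
split.
- move=> [J1 [J2 [[i1 p1] [i2 p2] J12 /smallest_eqT JT]]].
  have H1 := hs_vertices_of i1; have H2 := hs_vertices_of i2.
  have HT H : hs H -> vertices_of J1 `|` vertices_of J2 `<=` H -> H = setT.
    move=> HH; rewrite subUset => -[H1H H2H]; rewrite -(ideal_ofK HH) (JT (ideal_of H)).
    + by apply/seteqP; split.
    + exact: order_ideal_of.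
    + by rewrite subUset; split;
        [rewrite -(vertices_ofK i1)|rewrite -(vertices_ofK i2)];
        exact: ideal_ofS.
  exists (vertices_of J1), (vertices_of J2); split=> //.
  (* If one vertex set were empty, the other alone would generate all vertices and its ideal would
     not be proper. *)
  + split=> H0.
      by apply: p2; rewrite -(vertices_ofK i2) (HT (vertices_of J2)) ?ideal_ofT // H0 set0U.
    by apply: p1; rewrite -(vertices_ofK i1) (HT (vertices_of J1)) ?ideal_ofT // H0 setU0.
  + rewrite -(ideal_ofK hs_set0) ideal_of0 -J12.
    by apply/seteqP; split.
  + exact/smallest_eqT.
- move=> [H1 [H2 [[h1 h2] [n1 n2] H12 /smallest_eqT HT]]].
  have i1 := order_ideal_of h1; have i2 := order_ideal_of h2.
  have ofT H : hs H -> ideal_of H = setT -> H = setT.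
    by move=> HH E; rewrite -(ideal_ofK HH) E; apply/seteqP; split.
  exists (ideal_of H1), (ideal_of H2); split.
  + by split=> // /(ofT _ h1) E; apply: n2; rewrite -H12 E setTI.
  + by split=> // /(ofT _ h2) E; apply: n1; rewrite -H12 E setIT.
  + by rewrite -ideal_ofI H12 ideal_of0.
  + apply/smallest_eqT => J iJ; rewrite subUset => -[J1 J2].
    rewrite -(vertices_ofK iJ) (HT (vertices_of J)) ?ideal_ofT //; first exact: hs_vertices_of.
    rewrite subUset; split.
      by rewrite -(ideal_ofK h1) => v /J1.
    by rewrite -(ideal_ofK h2) => v /J2.
Qed.

(** * Infinite paths and the prime ideals they define *)

Definition reach u v := exists2 a : mor L, rng a = u & src a = v.

Lemma reach_trans v u w : reach u v -> reach v w -> reach u w.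
Proof.
move=> [a au av] [b bv bw]; have ab : src a = rng b by rewrite av bv.
by exists (mcomp a b); [rewrite rng_comp|rewrite src_comp].
Qed.

Lemma reach_hereditary H u v : hereditary H -> H u -> reach u v -> H v.
Proof. by move=> Hh Hu [a au <-]; apply: (Hh u Hu (deg a)); exists a. Qed.

Lemma path_prefix (a : mor L) (n : 'rV[nat]_k) : (forall i, n ord0 i <= deg a ord0 i)%N ->
  exists2 b, paths (rng a) n b & reach (src b) (src a).
Proof.
move=> na; have E : deg a = n + (\row_i (deg a ord0 i - n ord0 i)%N).
  apply/rowP => i; rewrite !mxE.
  by rewrite -[LHS](subnKC (na i)).
have [[b c] /= [[bn _ bc bca] _]] := factorization E.
exists b; first by split=> //; rewrite -bca rng_comp.
by exists c => //; rewrite -bca src_comp.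
Qed.

Section PathComplement.
Variable x : nat -> obj L.
Hypothesis xP : forall j, exists2 a, paths (x j) (const_mx 1%N) a & src a = x j.+1.

Lemma long_path j i : exists2 a,
  paths (x j) (const_mx i) a & src a = x (j + i)%N.
Proof.
elim: i => [|i [a [da ra] sa]].
  exists (idm (x j)); last by rewrite src_idm addn0.
  by split; [rewrite deg_idm; apply/rowP => ?; rewrite !mxE|rewrite rng_idm].
have [b [db rb] sb] := xP (j + i).
have ab : src a = rng b by rewrite sa rb.
exists (mcomp a b); last by rewrite src_comp // sb addnS.
split; last by rewrite rng_comp.
rewrite deg_comp // da db; apply/rowP => ?; rewrite !mxE.
exact: addn1.
Qed.

Lemma reach_path j i : reach (x j) (x (j + i)%N).
Proof. by have [a []] := long_path j i; exists a. Qed.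

Definition path_complement : set (obj L) := [set w | forall j, ~ reach w (x j)].

(** For saturation, suppose [v] reaches the path. Following the path far enough gives a morphism of
    degree at least [n]; the source of its prefix of degree [n] still reaches the path. *)
Lemma hs_path_complement : hs path_complement.
Proof.
split=> [v vM n _ [a [_ av] <-] j aj|v [n vn] j [a av aj]].
  by apply: (vM j); apply: reach_trans aj; exists a.
(* The path advances by degree (1,...,1), so [i] steps dominate every coordinate of [n]. *)
set i := (\max_(l < k) n ord0 l)%N.
have [b [db rb] sb] := long_path j i.
have ab : src a = rng b by rewrite aj rb.
have [|c] := @path_prefix (mcomp a b) n.
  move=> l; rewrite deg_comp // db !mxE.
  by apply: leq_trans (leq_addl _ _); exact: leq_bigmax.
rewrite rng_comp // src_comp // av sb => vc.
by apply: vn; exists c.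
Qed.

(** If [u] in [H1] and [v] in [H2] reach the path at [x i] and [x j], both reach [x (i + j)], which
    then lies in [H1] and [H2] by heredity but not in the complement. *)
Lemma path_complement_prime H1 H2 : hs H1 -> hs H2 ->
  H1 `&` H2 `<=` path_complement ->
  H1 `<=` path_complement \/ H2 `<=` path_complement.
Proof.
move=> [h1 _] [h2 _] H12.
have [|/existsNP[u /not_implyP[H1u /existsNP[i /contrapT ui]]]] :=
  EM (H1 `<=` path_complement); first by left.
right=> v H2v j vj.
apply: (H12 (x (i + j)%N) _ (i + j)%N).
  split; [apply: reach_hereditary h1 H1u _|apply: reach_hereditary h2 H2v _].
    exact: reach_trans ui (reach_path _ _).
  by rewrite addnC; exact: reach_trans vj (reach_path _ _).
by rewrite -{2}(addn0 (i + j)%N); exact: reach_path.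
Qed.

End PathComplement.

(* Follow an infinite path out of [v] avoiding [H]; the vertices from which
   this path cannot be reached form the required set. *)
Lemma hs_separation H v : hs H -> ~ H v -> exists M,
  [/\ hs M, forall H1 H2, hs H1 -> hs H2 -> H1 `&` H2 `<=` M ->
        H1 `<=` M \/ H2 `<=` M, H `<=` M & ~ M v].
Proof.
move=> [Hh Hs] Hv.
(* Saturation yields an edge of the path that stays outside [H]; at vertices of [H] the value of [f]
   is arbitrary. *)
have /choice [f fP] : forall w, exists w', ~ H w -> ~ H w' /\
    exists2 a, paths w (const_mx 1%N) a & src a = w'.
  move=> w; have [Hw|Hw] := EM (H w); first by exists w.
  have : ~ (@src k L @` paths w (const_mx 1%N) `<=` H).
    by move=> wH; apply: Hw; apply: Hs; exists (const_mx 1%N).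
  move=> /existsNP[_ /not_implyP[[a wa <-] Ha]].
  by exists (src a) => _; split=> //; exists a.
pose x j := iter j f v.
have xH j : ~ H (x j) by elim: j => [//|j IH]; case: (fP _ IH).
have xP j : exists2 a, paths (x j) (const_mx 1%N) a & src a = x j.+1.
  by case: (fP _ (@xH j)).
exists (path_complement x); split.
- exact: hs_path_complement.
- exact: path_complement_prime.
- by move=> w Hw j wj; apply: (@xH j); exact: reach_hereditary wj.
- by move=> /(_ 0%N); apply; have := reach_path xP 0 0.
Qed.

(** Some generator in the representative of [t] has its vertex outside [vertices_of J]. Separating
    that vertex by [M] also keeps [t] out of [ideal_of M]. *)
Lemma spec_separation J t : ideal J -> ~ J t ->
  exists2 P : Spec (@tshift k L), J `<=` P & ~ spec_ideal P t.
Proof.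
move=> iJ; rewrite -{1}(tprojK t) tproj_sum ideal_sum //.
move=> /existsNP[g /not_implyP[gt]]; rewrite ideal_tgen // => Jg.
have HJ := hs_vertices_of iJ.
have [M [HM Mp JM Mg]] := hs_separation HJ Jg.
have Pt : ~ ideal_of M t by move=> /(_ g); rewrite -in_mset => /(_ gt).
have pP : prime_ideal (@tshift k L) (ideal_of M).
  split; first by split; [exact: order_ideal_of|move=> E; apply: Pt; rewrite E].
  move=> J1 J2 i1 i2 J12.
  have := Mp _ _ (hs_vertices_of i1) (hs_vertices_of i2).
  rewrite -{3}(vertices_ofK i1) -{3}(vertices_ofK i2).
  case.
  + by move=> w /J12 /(ideal_of_tgen _ _ HM).
  + by left; exact: ideal_ofS.
  + by right; exact: ideal_ofS.
exists (MkSpec pP) => //=.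
by rewrite -(vertices_ofK iJ); exact: ideal_ofS.
Qed.

(** * Connected components *)

Definition component u : set (obj L) := [set v | clos_refl_sym_trans (obj L)
  (fun v w => exists a : mor L, rng a = v /\ src a = w) u v].

(** The ends of a morphism share a component. For saturation, some path of degree [n] leaves [v],
    and its source decides where [v] lies. *)
Lemma hs_component u : hs (component u) /\ hs (~` component u).
Proof.
set C := component u.
have Ca a : C (rng a) <-> C (src a).
  have aa : clos_refl_sym_trans (obj L)
    (fun v w => exists a : mor L, rng a = v /\ src a = w) (rng a) (src a).
    by apply: rst_step; exists a.
  by split=> ?; [apply: rst_trans aa|apply: rst_trans (rst_sym _ _ _ _ aa)].
split; split=> [v Cv n _ [a [_ av] <-]|v [n vn]].
- by apply/Ca; rewrite av.
- have [a [da av]] := hns v n.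
  by rewrite -av; apply/Ca; apply: vn; exists a.
- by move=> /Ca; rewrite av.
- have [a [da av]] := hns v n.
  by rewrite -av => /Ca; apply: vn; exists a.
Qed.

End TalentedIdeals.

Theorem theorem5p8 (k : nat) (hk : (0 < k)%N) (L : kgraph k)
    (hrf : row_finite L) (hns : without_sources L) :
  let spec_connected := connected [set: Spec (@tshift k L)] in
  let T_indecomposable := indecomposable (@tshift k L) in
  let no_splitting := ~ exists H1 H2 : set (obj L),
    [/\ hereditary_saturated H1 /\ hereditary_saturated H2,
        H1 <> set0 /\ H2 <> set0,
        H1 `&` H2 = set0
      & hs_closure (H1 `|` H2) = setT] in
  [/\ spec_connected <-> T_indecomposable,
      T_indecomposable <-> no_splitting
    & spec_connected \/ T_indecomposable \/ no_splitting ->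
      kgraph_connected L].
Proof.
move=> spec_connected T_indecomposable no_splitting.
have i_ii : spec_connected <-> T_indecomposable.
  apply: connected_spec_indecomposable.
    by rewrite -(ideal_of0 hrf hns); exact: order_ideal_of (hs_set0 hns).
  by move=> J t; exact: spec_separation.
have ii_iii : T_indecomposable <-> no_splitting.
  by rewrite /T_indecomposable /indecomposable decomposable_split.
split=> // H; have {H} nosplit : no_splitting.
  by case: H => [/i_ii/ii_iii|[/ii_iii|]].
(* If [u] and [v] are not connected, the component of [u] and its complement are nonempty and
   already cover all vertices. *)
move=> u v; apply: contrapT => uv; apply: nosplit.
have [hC hCc] := hs_component hns u.
exists (component u), (~` component u); split=> //.
- split=> E.
    suff : set0 u by []. by rewrite -E; exact: rst_refl.
  by suff : set0 v by []; rewrite -E.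
- exact: setICr.
- apply/smallest_eqT => M _; rewrite setUCr => TM.
  by apply/seteqP; split.
Qed.
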